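(* Let $\mathcal{D}$ be a balanced quadriculated disk. Suppose that $\mathcal{D}$ contains a unit square $s$ such that $\mathcal{D}\smallsetminus s$ has at least three connected components. If the largest connected component of $\mathcal{D}\smallsetminus s$ has size at most $|\mathcal{D}|-4$, then $\mathcal{D}$ is strongly irregular.
   Context: A quadriculated disk $\mathcal{D}\subset\mathbb{R}^2$ is a finite union of closed unit squares with vertices in $\mathbb{Z}^2$ that is homeomorphic to a closed disk. The unit square $[a,a+1]\times[b,b+1]$, $(a,b)\in\mathbb{Z}^2$, is white if $a+b$ is even and black if $a+b$ is odd. Two unit squares are adjacent if they share an edge; a planar domino is a union of two adjacent unit squares. $\mathcal{D}$ is balanced if it contains equally many white and black unit squares. The size $|\cdot|$ of a union of unit squares is its number of unit squares. Connected components of $\mathcal{D}\smallsetminus s$ are identified with the corresponding sets of unit squares (connected via shared edges). Domino group. A plug is a union $p\subseteq\mathcal{D}$ of unit squares of $\mathcal{D}$ with equally many white and black squares; $\mathbf{p}_\circ=\emptyset$ is the empty plug. Two plugs are disjoint if their interiors are disjoint. The 2-complex $\mathcal{C}_{\mathcal{D}}$ is defined as follows. - Vertices: the plugs. - Edges: for every two distinct disjoint plugs $p_1,p_2$, one edge between $p_1$ and $p_2$ for each planar domino tiling of $\mathcal{D}\smallsetminus\mathrm{int}(p_1\cup p_2)$ (the empty region has exactly one tiling, the empty one); also one loop at $\mathbf{p}_\circ$ for each planar domino tiling of $\mathcal{D}$. - 2-cells: (i) for each loop $f$, a disk attached along $f*f$ (so that a projective plane results); (ii) for each two edges joining the same two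 distinct plugs whose tilings differ by a single planar flip (replacing two parallel dominoes forming a $2\times2$ square by the other two), a disk attached along the resulting bigon; (iii) for each four plugs $p_1,p_2,p_3,p_4$ with $p_2$ disjoint from $p_1$ and from $p_4$, and $p_2=p_3\cup d$ where $d$ is a domino whose two unit squares are not in $p_3$, and for each tiling $f_1^*$ of $\mathcal{D}\smallsetminus\mathrm{int}(p_1\cup p_2)$ and each tiling $f_2^*$ of $\mathcal{D}\smallsetminus\mathrm{int}(p_2\cup p_4)$, a disk attached along the quadrilateral $p_1\to p_2\to p_4\to p_3\to p_1$ with edges $f_1^*$, $f_2^*$, $f_2^*\cup\{d\}$, $f_1^*\cup\{d\}$. The domino group is $G_{\mathcal{D}}=\pi_1(\mathcal{C}_{\mathcal{D}},\mathbf{p}_\circ)$. The even domino group $G_{\mathcal{D}}^+$ is the kernel of the homomorphism $G_{\mathcal{D}}\to\mathbb{Z}/(2)$ sending a closed edge path of length $N$ to $N \bmod 2$. The disk $\mathcal{D}$ is strongly irregular if there exists a surjective homomorphism from $G_{\mathcal{D}}^+$ onto the free group $F_2$ of rank two. *)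

(* Defs.v *)
From HB Require Import structures.
From mathcomp Require Import all_boot all_order all_algebra.
From mathcomp Require Import finmap.
From mathcomp Require Import boolp classical_sets functions reals topology.
From mathcomp Require Import normedtype.

Set Implicit Arguments.
Unset Strict Implicit.
Unset Printing Implicit Defensive.

Import Order.TTheory GRing.Theory Num.Theory.
Import numFieldNormedType.Exports.

Local Open Scope quotient_scope.
Local Open Scope classical_set_scope.
Local Open Scope fset_scope.

(* The pair (a, b) stands for the unit square [a, a + 1] x [b, b + 1]. *)
Notation cell := (int * int)%type.
Notation region := {fset cell}.

Definition white (c : cell) : bool := (2 %| (c.1 + c.2)%R)%Z.

Definition balanced (A : region) : bool :=
  #|` [fset c in A | white c]| == #|` [fset c in A | ~~ white c]|.

Definition adjacent (c c' : cell) : bool :=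
  (`|c.1 - c'.1| + `|c.2 - c'.2| == 1 :> int)%R.

Definition homeomorphic (T U : topologicalType) (A : set T) (B : set U) : Prop :=
  exists (f : T -> U) (g : U -> T),
    [/\ set_bij A B f, {in A, cancel f g},
        {within A, continuous f} & {within B, continuous g}].

Section Plane.
Variable R : realType.
Local Open Scope ring_scope.

Definition unit_square (c : cell) : set (R * R) :=
  [set x | c.1%:~R <= x.1 <= c.1%:~R + 1 /\ c.2%:~R <= x.2 <= c.2%:~R + 1].

Definition realization (A : region) : set (R * R) :=
  [set x | exists2 c, c \in A & unit_square c x].

Definition closed_disk : set (R * R) :=
  [set x | x.1 ^+ 2 + x.2 ^+ 2 <= 1].

Definition quadriculated_disk (A : region) : Prop :=
  homeomorphic (realization A) closed_disk.

End Plane.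

Definition components (A : region) : {set {set A}} :=
  equivalence_partition
    (connect [rel a b : A | adjacent (val a) (val b)]) [set: A].

(* The group of equivalence classes of a type whose group laws hold only up to
   an equivalence relation. *)
Record setoid_group := SetoidGroup {
  sg_sort :> choiceType;
  sg_eq : sg_sort -> sg_sort -> Prop;
  sg_one : sg_sort;
  sg_inv : sg_sort -> sg_sort;
  sg_mul : sg_sort -> sg_sort -> sg_sort;
  sg_refl : forall x, sg_eq x x;
  sg_sym : forall x y, sg_eq x y -> sg_eq y x;
  sg_trans : forall y x z, sg_eq x y -> sg_eq y z -> sg_eq x z;
  sg_eqM : forall x x' y y', sg_eq x x' -> sg_eq y y' ->
    sg_eq (sg_mul x y) (sg_mul x' y');
  sg_eqV : forall x x', sg_eq x x' -> sg_eq (sg_inv x) (sg_inv x');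
  sg_mulA : forall x y z,
    sg_eq (sg_mul x (sg_mul y z)) (sg_mul (sg_mul x y) z);
  sg_mul1 : forall x, sg_eq (sg_mul sg_one x) x;
  sg_mulr1 : forall x, sg_eq (sg_mul x sg_one) x;
  sg_mulV : forall x, sg_eq (sg_mul (sg_inv x) x) sg_one;
  sg_mulrV : forall x, sg_eq (sg_mul x (sg_inv x)) sg_one
}.

Section QuotientGroup.
Variable S : setoid_group.

Definition sg_rel (x y : S) : bool := `[< sg_eq x y >].

Fact sg_rel_refl : reflexive sg_rel.
Proof. by move=> x; apply/asboolP/sg_refl. Qed.

Fact sg_rel_sym : symmetric sg_rel.
Proof. by move=> x y; apply/asboolP/asboolP; apply: sg_sym. Qed.

Fact sg_rel_trans : transitive sg_rel.
Proof.
by move=> y x z /asboolP xy /asboolP yz; apply/asboolP; apply: sg_trans xy yz.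
Qed.

Definition sg_equiv := EquivRel sg_rel sg_rel_refl sg_rel_sym sg_rel_trans.

Definition quotient_group := {eq_quot sg_equiv}.

HB.instance Definition _ := Choice.on quotient_group.
HB.instance Definition _ := Quotient.on quotient_group.

Lemma quotient_groupP (x y : S) :
  (\pi_quotient_group x = \pi_quotient_group y) <-> sg_eq x y.
Proof.
split=> [/eqmodP|xy]; first by move/asboolP.
by apply/eqmodP/asboolP.
Qed.

Definition qg_one : quotient_group := \pi_quotient_group (sg_one S).
Definition qg_inv (x : quotient_group) : quotient_group := \pi_quotient_group (sg_inv (repr x)).
Definition qg_mul (x y : quotient_group) : quotient_group :=
  \pi_quotient_group (sg_mul (repr x) (repr y)).

Lemma qg_invE x : qg_inv (\pi_quotient_group x) = \pi_quotient_group (sg_inv x).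
Proof.
apply/quotient_groupP/sg_eqV/quotient_groupP; exact: reprK.
Qed.

Lemma qg_mulE x y : 
  qg_mul (\pi_quotient_group x) (\pi_quotient_group y) =
  \pi_quotient_group (sg_mul x y).
Proof.
apply/quotient_groupP/sg_eqM; apply/quotient_groupP; exact: reprK.
Qed.

Fact qg_mulA : associative qg_mul.
Proof.
elim/quotW=> x; elim/quotW=> y; elim/quotW=> z.
rewrite (qg_mulE y z) (qg_mulE x y) !qg_mulE.
exact/quotient_groupP/sg_mulA.
Qed.

Fact qg_mul1 : left_id qg_one qg_mul.
Proof. by elim/quotW=> x; rewrite qg_mulE; apply/quotient_groupP/sg_mul1. Qed.

Fact qg_mulr1 : right_id qg_one qg_mul.
Proof. by elim/quotW=> x; rewrite qg_mulE; apply/quotient_groupP/sg_mulr1. Qed.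

Fact qg_mulV : left_inverse qg_one qg_inv qg_mul.
Proof.
by elim/quotW=> x; rewrite qg_invE qg_mulE; apply/quotient_groupP/sg_mulV.
Qed.

Fact qg_mulrV : right_inverse qg_one qg_inv qg_mul.
Proof.
by elim/quotW=> x; rewrite qg_invE qg_mulE; apply/quotient_groupP/sg_mulrV.
Qed.

HB.instance Definition _ :=
  isGroup.Build quotient_group qg_mulA qg_mul1 qg_mulr1 qg_mulV qg_mulrV.

End QuotientGroup.

(* The letter (i, false) is the i-th generator, (i, true) its formal inverse. *)
Section FreeGroup.
Variable n : nat.
Let letter := ('I_n * bool)%type.

Definition letter_inv (x : letter) : letter := (x.1, ~~ x.2).

Definition word_inv (w : seq letter) : seq letter := rev (map letter_inv w).

Inductive free_eq : seq letter -> seq letter -> Prop :=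
| free_refl w : free_eq w w
| free_sym w w' : free_eq w w' -> free_eq w' w
| free_trans w' w w'' : free_eq w w' -> free_eq w' w'' -> free_eq w w''
| free_cancel u x v : free_eq (u ++ [:: x; letter_inv x] ++ v) (u ++ v).

Lemma letter_invK : involutive letter_inv.
Proof. by case=> i b; rewrite /letter_inv negbK. Qed.

Lemma word_invK : involutive word_inv.
Proof. by move=> w; rewrite /word_inv map_rev revK mapK //; exact: letter_invK. Qed.

Lemma word_inv_cat u v : word_inv (u ++ v) = word_inv v ++ word_inv u.
Proof. by rewrite /word_inv map_cat rev_cat. Qed.

Lemma free_eq_ctx a b w w' : free_eq w w' -> free_eq (a ++ w ++ b) (a ++ w' ++ b).
Proof.
elim=> [w1|w1 w2 _|w2 w1 w3 _ IH1 _ IH2|u x v]; first exact: free_refl.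
- exact: free_sym.
- exact: free_trans IH1 IH2.
- by rewrite -!catA !(catA a u); apply: free_cancel.
Qed.

Fact free_eqM u u' v v' : free_eq u u' -> free_eq v v' -> free_eq (u ++ v) (u' ++ v').
Proof.
move=> uu' vv'; apply: (@free_trans (u' ++ v)).
  exact: (free_eq_ctx [::] v uu').
by have := free_eq_ctx u' [::] vv'; rewrite !cats0.
Qed.

Fact free_eqV w w' : free_eq w w' -> free_eq (word_inv w) (word_inv w').
Proof.
elim=> [w1|w1 w2 _|w2 w1 w3 _ IH1 _ IH2|u x v]; first exact: free_refl.
- exact: free_sym.
- exact: free_trans IH1 IH2.
- rewrite !word_inv_cat -catA.
  have ->: word_inv [:: x; letter_inv x] = [:: x; letter_inv x].
    by rewrite /word_inv /= letter_invK.
  exact: free_cancel.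
Qed.

Fact free_mulrV w : free_eq (w ++ word_inv w) [::].
Proof.
elim: w => [|x w IH]; first exact: free_refl.
rewrite -cat1s word_inv_cat -!catA.
apply: (@free_trans ([:: x] ++ [::] ++ word_inv [:: x])).
  by have := free_eq_ctx [:: x] (word_inv [:: x]) IH; rewrite -!catA.
exact: (free_cancel [::] x [::]).
Qed.

Fact free_mulV w : free_eq (word_inv w ++ w) [::].
Proof. by rewrite -{2}[w]word_invK; apply: free_mulrV. Qed.

Definition free_setoid_group : setoid_group :=
  @SetoidGroup (seq letter) free_eq [::] word_inv cat
    free_refl free_sym free_trans free_eqM free_eqV
    (fun u v w => eq_ind _ (free_eq _) (free_refl _) _ (catA u v w))
    free_refl (fun w => eq_ind_r (free_eq^~ w) (free_refl w) (cats0 w))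
    free_mulV free_mulrV.

Definition free_group : groupType := quotient_group free_setoid_group.

End FreeGroup.

Definition domino (d : region) : Prop :=
  exists c c', adjacent c c' /\ d = [fset c; c'].

Definition tiling (A : region) (t : {fset region}) : Prop :=
  [/\ forall d, d \in t -> domino d, trivIfset t & fcover t = A].

Definition hpair (c : cell) : {fset region} :=
  [fset [fset c; (c.1 + 1, c.2)%R];
        [fset (c.1, c.2 + 1)%R; (c.1 + 1, c.2 + 1)%R]].

Definition vpair (c : cell) : {fset region} :=
  [fset [fset c; (c.1, c.2 + 1)%R];
        [fset (c.1 + 1, c.2)%R; (c.1 + 1, c.2 + 1)%R]].

Definition flip (t t' : {fset region}) : Prop :=
  exists c, (hpair c `<=` t /\ t' = (t `\` hpair c) `|` vpair c) \/
            (vpair c `<=` t /\ t' = (t `\` vpair c) `|` hpair c).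

(* An oriented edge of the complex.  Between distinct plugs the orientation is
   determined by the end points; for a loop, dreversed tells its two
   orientations apart (and it is false for every edge that is not a loop). *)
Record dart := Dart {
  dsource : region;
  dtarget : region;
  dtiling : {fset region};
  dreversed : bool
}.

Definition dart_tuple (e : dart) :=
  (dsource e, dtarget e, dtiling e, dreversed e).
Definition tuple_dart (x : region * region * {fset region} * bool) :=
  let: (p, q, t, b) := x in Dart p q t b.
Fact dart_tupleK : cancel dart_tuple tuple_dart. Proof. by case. Qed.
HB.instance Definition _ := Choice.copy dart (can_type dart_tupleK).

Definition edge (p q : region) (t : {fset region}) : dart := Dart p q t false.

Definition dart_rev (e : dart) : dart :=
  Dart (dtarget e) (dsource e) (dtiling e)
       (dreversed e (+) (dsource e == dtarget e)).

Section DominoComplex.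
Variable D : region.

Definition plug (p : region) : bool := (p `<=` D) && balanced p.

(* Disjoint plugs that are equal are empty, so that the only loops are the
   tilings of D, at the empty plug. *)
Definition is_dart (e : dart) : bool :=
  [&& plug (dsource e), plug (dtarget e), [disjoint dsource e & dtarget e]%fset,
      `[< tiling (D `\` (dsource e `|` dtarget e)) (dtiling e) >]
    & dreversed e ==> (dsource e == dtarget e)].

Fixpoint is_path (p q : region) (w : seq dart) : bool :=
  if w is e :: w' then [&& is_dart e, dsource e == p & is_path (dtarget e) q w']
  else p == q.

(* The boundaries of the disks.  That the edges belong to the complex is
   required where a boundary is used, in [homotopic].  Some edges of the third
   boundary can be loops; their orientation is then immaterial, thanks to the
   first kind of disks. *)
Inductive boundary : seq dart -> Prop :=
| boundary_loop f : dsource f = dtarget f -> boundary [:: f; f]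
| boundary_flip p q t t' : p != q -> flip t t' ->
    boundary [:: edge p q t; edge q p t']
| boundary_domino p1 p2 p3 p4 d t1 t2 :
    domino d -> [disjoint d & p3]%fset -> p2 = p3 `|` d ->
    boundary [:: edge p1 p2 t1; edge p2 p4 t2;
                 edge p4 p3 (d |` t2); edge p3 p1 (d |` t1)].

(* Homotopy of edge paths relative to the end points p and q. *)
Inductive homotopic (p q : region) : seq dart -> seq dart -> Prop :=
| homotopic_refl w : homotopic p q w w
| homotopic_sym w w' : homotopic p q w w' -> homotopic p q w' w
| homotopic_trans w' w w'' :
    homotopic p q w w' -> homotopic p q w' w'' -> homotopic p q w w''
| homotopic_spur u e v : is_path p q (u ++ [:: e; dart_rev e] ++ v) ->
    homotopic p q (u ++ [:: e; dart_rev e] ++ v) (u ++ v)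
| homotopic_disk u c v : boundary c -> is_path p q (u ++ c ++ v) ->
    homotopic p q (u ++ c ++ v) (u ++ v).

Definition path_rev (w : seq dart) : seq dart := rev (map dart_rev w).

Definition closed_path := {w : seq dart | is_path fset0 fset0 w}.

Lemma dart_revK : involutive dart_rev.
Proof. by case=> p q t b; rewrite /dart_rev /= eq_sym -addbA addbb addbF. Qed.

Lemma path_revK : involutive path_rev.
Proof. by move=> w; rewrite /path_rev map_rev revK mapK //; exact: dart_revK. Qed.

Lemma path_rev_cat u v : path_rev (u ++ v) = path_rev v ++ path_rev u.
Proof. by rewrite /path_rev map_cat rev_cat. Qed.

Lemma is_dart_rev e : is_dart (dart_rev e) = is_dart e.
Proof.
rewrite /is_dart /= fdisjoint_sym fsetUC andbCA; do 4!congr (_ && _).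
by rewrite eq_sym; case: (dreversed e); case: eqP.
Qed.

Lemma is_path_cat p q u v :
  reflect (exists2 r, is_path p r u & is_path r q v) (is_path p q (u ++ v)).
Proof.
elim: u p => [|e u IH] p /=.
  apply: (iffP idP) => [pv|[r /eqP-> //]]; by exists p.
apply: (iffP and3P) => [[eD ep /IH[r ur rv]]|[r /and3P[eD ep ur] rv]].
  by exists r => //; rewrite eD ep.
by split=> //; apply/IH; exists r.
Qed.

Lemma is_path_rev p q w : is_path p q w -> is_path q p (path_rev w).
Proof.
elim: w p => [|e w IH] p /=; first by rewrite eq_sym.
case/and3P=> eD /eqP <- /IH wp; rewrite -cat1s path_rev_cat.
apply/is_path_cat; exists (dtarget e) => //=.
by rewrite is_dart_rev eD !eqxx.
Qed.

Lemma boundary_closed p q c : boundary c -> is_path p q c -> p = q.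
Proof.
case=> [f ff|p' q' t t' _ _|p1 p2 p3 p4 d t1 t2 _ _ _] /=.
- by case/and3P=> _ /eqP <- /and3P[_ _ /eqP <-].
- by case/and3P=> _ /eqP <- /and3P[_ _ /eqP <-].
- by case/and3P=> _ /eqP <- /and3P[_ _ /and3P[_ _ /and3P[_ _ /eqP <-]]].
Qed.

Lemma homotopic_ctx p q r s a b w w' :
  is_path r p a -> is_path q s b -> homotopic p q w w' ->
  homotopic r s (a ++ w ++ b) (a ++ w' ++ b).
Proof.
move=> aP bP; have ctx x : is_path p q x -> is_path r s (a ++ x ++ b).
  move=> xP; apply/is_path_cat; exists p => //.
  by apply/is_path_cat; exists q.
elim=> [w1|w1 w2 _|w2 w1 w3 _ IH1 _ IH2|u e v eP|u c v cB cP].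
- exact: homotopic_refl.
- exact: homotopic_sym.
- exact: homotopic_trans IH1 IH2.
- have := ctx _ eP; rewrite -!catA !(catA a u); exact: homotopic_spur.
- have := ctx _ cP; rewrite -!catA !(catA a u); exact: homotopic_disk.
Qed.

Lemma homotopic_cat p q r u u' v v' :
    is_path q r v -> is_path p q u' ->
    homotopic p q u u' -> homotopic q r v v' ->
  homotopic p r (u ++ v) (u' ++ v').
Proof.
move=> vP uP uu' vv'; apply: (@homotopic_trans _ _ (u' ++ v)).
  by apply: (@homotopic_ctx p q p r [::]); rewrite /= ?eqxx.
have := @homotopic_ctx _ _ p r u' [::] _ _ uP _ vv'; rewrite !cats0; apply.
exact: eqxx.
Qed.

Lemma homotopic_revr p q w : is_path p q w -> homotopic p p (w ++ path_rev w) [::].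
Proof.
elim: w p => [|e w IH] p /=; first by move=> _; exact: homotopic_refl.
case/and3P=> eD /eqP ep wP; rewrite -[e :: _]cat1s -[e :: w]cat1s path_rev_cat.
have eP : is_path p (dtarget e) [:: e] by rewrite /= eD ep !eqxx.
have eP' := is_path_rev eP.
apply: (@homotopic_trans _ _ ([:: e] ++ [::] ++ path_rev [:: e])); last first.
  apply: (@homotopic_spur _ _ [::] e [::]).
  by rewrite /= is_dart_rev eD ep !eqxx.
by have := homotopic_ctx eP eP' (IH _ wP); rewrite -!catA.
Qed.

Lemma homotopic_revl p q w : is_path p q w -> homotopic q q (path_rev w ++ w) [::].
Proof. by move/is_path_rev/homotopic_revr; rewrite path_revK. Qed.

Lemma homotopic_rev p q w w' :
  homotopic p q w w' -> homotopic q p (path_rev w) (path_rev w').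
Proof.
elim=> [w1|w1 w2 _|w2 w1 w3 _ IH1 _ IH2|u e v eP|u c v cB cP].
- exact: homotopic_refl.
- exact: homotopic_sym.
- exact: homotopic_trans IH1 IH2.
- move/is_path_rev: eP; rewrite !path_rev_cat -catA.
  have -> : path_rev [:: e; dart_rev e] = [:: e; dart_rev e].
    by rewrite /path_rev /= dart_revK.
  exact: homotopic_spur.
- case/is_path_cat: cP => r uP /is_path_cat[r' cP vP].
  have rr' := boundary_closed cB cP; rewrite -{r'}rr' in cP vP.
  have [uP' vP'] := (is_path_rev uP, is_path_rev vP).
  have cP' := is_path_rev cP.
  rewrite !path_rev_cat -catA; apply: (homotopic_ctx (w' := [::]) vP' uP').
  apply: (@homotopic_trans _ _ (path_rev c ++ c)); last exact: homotopic_revl cP.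
  have := @homotopic_disk r r (path_rev c) c [::] cB.
  rewrite !cats0 => /(_ _)/homotopic_sym; apply.
  by apply/is_path_cat; exists r.
Qed.

Fact closed_path0P : is_path fset0 fset0 [::].
Proof. exact: eqxx. Qed.

Fact closed_path_catP (u v : closed_path) :
  is_path fset0 fset0 (val u ++ val v).
Proof. by apply/is_path_cat; exists fset0; apply: valP. Qed.

Fact closed_path_revP (u : closed_path) :
  is_path fset0 fset0 (path_rev (val u)).
Proof. exact/is_path_rev/(valP u). Qed.

Definition closed_path_one : closed_path := Sub [::] closed_path0P.
Definition closed_path_mul (u v : closed_path) : closed_path :=
  Sub (val u ++ val v) (closed_path_catP u v).
Definition closed_path_inv (u : closed_path) : closed_path :=
  Sub (path_rev (val u)) (closed_path_revP u).

Definition closed_path_eq (u v : closed_path) : Prop :=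
  homotopic fset0 fset0 (val u) (val v).

Fact closed_path_eqM u u' v v' : closed_path_eq u u' -> closed_path_eq v v' ->
  closed_path_eq (closed_path_mul u v) (closed_path_mul u' v').
Proof. by apply: homotopic_cat; apply: valP. Qed.

Fact closed_path_eqV u u' : closed_path_eq u u' ->
  closed_path_eq (closed_path_inv u) (closed_path_inv u').
Proof. exact: homotopic_rev. Qed.

Fact closed_path_mulA u v w :
  closed_path_eq (closed_path_mul u (closed_path_mul v w))
                 (closed_path_mul (closed_path_mul u v) w).
Proof. by rewrite /closed_path_eq /= catA; apply: homotopic_refl. Qed.

Fact closed_path_mul1 u : closed_path_eq (closed_path_mul closed_path_one u) u.
Proof. exact: homotopic_refl. Qed.

Fact closed_path_mulr1 u : closed_path_eq (closed_path_mul u closed_path_one) u.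
Proof. by rewrite /closed_path_eq /= cats0; apply: homotopic_refl. Qed.

Fact closed_path_mulV u :
  closed_path_eq (closed_path_mul (closed_path_inv u) u) closed_path_one.
Proof. exact: homotopic_revl (valP u). Qed.

Fact closed_path_mulrV u :
  closed_path_eq (closed_path_mul u (closed_path_inv u)) closed_path_one.
Proof. exact: homotopic_revr (valP u). Qed.

Definition loop_setoid_group : setoid_group :=
  @SetoidGroup closed_path closed_path_eq
    closed_path_one closed_path_inv closed_path_mul
    (fun u => homotopic_refl _ _ (val u)) (fun u v => @homotopic_sym _ _ _ _)
    (fun v u w => @homotopic_trans _ _ _ _ _)
    closed_path_eqM closed_path_eqV closed_path_mulA
    closed_path_mul1 closed_path_mulr1 closed_path_mulV closed_path_mulrV.

Definition domino_group : groupType := quotient_group loop_setoid_group.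

Definition path_class (w : closed_path) : domino_group :=
  \pi_(quotient_group loop_setoid_group) w.

Lemma homotopic_parity p q w w' :
  homotopic p q w w' -> odd (size w) = odd (size w').
Proof.
elim=> [//|w1 w2 _ -> //|w2 w1 w3 _ -> _ //|u e v _|u c v cB _].
- by rewrite !size_cat !oddD addbA addbF.
- have cE : odd (size c) = false by case: cB.
  by rewrite !size_cat !oddD cE.
Qed.

Definition length_parity (g : domino_group) : 'Z_2 :=
  inZp (size (val (repr (g : quotient_group loop_setoid_group)))).

Lemma length_parityE w : length_parity (path_class w) = inZp (size (val w)).
Proof.
have: closed_path_eq (repr (path_class w : quotient_group _)) w.
  exact/(quotient_groupP (S := loop_setoid_group))/reprK.
move/homotopic_parity => e; apply/val_inj; rewrite /= !modn2.
exact: (congr1 nat_of_bool e).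
Qed.

Fact length_parityM : {morph length_parity : g h / (g * h)%g}.
Proof.
move=> g h; rewrite /length_parity [LHS]length_parityE.
apply/val_inj; rewrite /= size_cat.
by rewrite modnDm.
Qed.

HB.instance Definition _ :=
  isMultiplicative.Build domino_group 'Z_2 length_parity length_parityM.

Definition even_pred : {pred domino_group} :=
  [pred g | length_parity g == 1%g].

Fact even_closed : group_closed even_pred.
Proof.
have par1 : length_parity 1%g = 1%g.
  by rewrite [LHS](length_parityE closed_path_one); apply/val_inj.
split=> [|g h]; first by rewrite inE par1.
rewrite !inE => /eqP gE /eqP hE.
have : length_parity (h^-1 * h)%g = 1%g by rewrite mulVg par1.
by rewrite !length_parityM hE gE mulg1 mul1g => ->.
Qed.

Definition even_domino_group := {g : domino_group | even_pred g}.

HB.instance Definition _ := SubChoice.on even_domino_group.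
HB.instance Definition _ :=
  SubChoice_isSubGroup.Build domino_group even_pred even_domino_group even_closed.

Definition strongly_irregular : Prop :=
  exists f : {multiplicative even_domino_group -> free_group 2},
    forall x, exists g, f g = x.

End DominoComplex.

(* Main.v *)
From HB Require Import structures.
Require Import Defs.
From mathcomp Require Import all_boot all_order all_algebra.
From mathcomp Require Import finmap.
From mathcomp Require Import boolp reals.
From mathcomp Require classical_sets functions cardinality filter topology.
From mathcomp Require normedtype.
From mathcomp Require Import ring lra zify.

Set Implicit Arguments.
Unset Strict Implicit.
Unset Printing Implicit Defensive.

Import Order.TTheory GRing.Theory Num.Theory.
Local Open Scope fset_scope.
Local Open Scope quotient_scope.

(* Let C range over the components of D minus s.  The colour imbalances of p
   in the components C, for a plug p met after an even number of steps (and of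
   its complement after an odd number of steps), change only when the floor
   matches s with a square of some C, and the graph of their possible values
   is part of a honeycomb lattice (with three components).  An even closed
   path thus projects to a loop of this graph, and no disk of the complex
   affects the projection.  Labelling two edges of the graph, both crossed
   when s is matched into a component C1, by the generators of the free group
   turns the projection into a homomorphism; only the imbalances of C1 and of
   a combination of the other components are needed to define it.  The walks
   around two hexagons, each through exactly one of the labelled edges, reach
   the generators.  Such a hexagon needs a component with two squares and two
   other components: either two components have two squares, or there is one
   with two squares and at least three others.
   That D is a disk is used to see that every component touches s: a disk
   minus a finite set of points is connected, so D is connected through
   edges. *)

(** * Weights of regions *)

Section Weights.
Local Open Scope ring_scope.

Definition weight (h : cell -> int) (A : region) : int := \sum_(c <- A) h c.

Lemma weight0 h : weight h fset0 = 0.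
Proof. by rewrite /weight big_seq_fset0. Qed.

Lemma weightU1 h a A : a \notin A -> weight h (a |` A) = h a + weight h A.
Proof. exact: big_fsetU1. Qed.

Lemma weight_pair h a b : a != b -> weight h [fset a; b] = h a + h b.
Proof. by move=> ab; rewrite weightU1 ?inE // /weight big_seq_fset1. Qed.

Lemma weightU h A B :
  [disjoint A & B] -> weight h (A `|` B) = weight h A + weight h B.
Proof.
move=> AB; rewrite /weight (big_fsetID _ (mem A)) /=; congr (_ + _).
  apply: eq_fbigl => x; rewrite !inE /=.
  by case: (x \in A); rewrite ?andbF // andbC.
apply: eq_fbigl => x; rewrite !inE /=.
case: (boolP (x \in A)) => [xA|_] /=; last by rewrite andbT.
exact/esym/negbTE/(fdisjointP AB).
Qed.

Lemma weightD h A B :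
  B `<=` A -> weight h (A `\` B) = weight h A - weight h B.
Proof.
move=> BA; have dB : [disjoint B & A `\` B].
  by apply/fdisjointP => x xB; rewrite inE xB.
have := weightU h dB.
by rewrite -{1}(fsetIidPr BA) fsetID => ->; rewrite addrC addKr.
Qed.

Definition color (c : cell) : int := if white c then 1 else -1.

Lemma balancedE A : balanced A = (weight color A == 0).
Proof.
rewrite /balanced !card_fset_sum1 /weight (big_fsetID _ white A color) /=.
have E (P : pred cell) (z : int) : (forall c, P c -> color c = z) ->
    \sum_(c <- [fset c in A | P c]) color c
    = z *+ (\sum_(c <- [fset c in A | P c]) 1)%N.
  move=> Pz; rewrite -sumrMnr big_seq [RHS]big_seq; apply: eq_bigr => c.
  by rewrite !inE => /andP[_ /Pz].
have Ew : forall c, white c -> color c = 1 by move=> c; rewrite /color => ->.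
have Eb : forall c, ~~ white c -> color c = -1.
  by move=> c; rewrite /color => /negbTE->.
rewrite [X in X + _](E white 1 Ew) [X in _ + X](E [pred c | ~~ white c] _ Eb).
by rewrite mulNrn subr_eq0 eqr_nat.
Qed.

Lemma adjacent_sym a b : adjacent a b = adjacent b a.
Proof. by rewrite /adjacent distrC [X in _ + X]distrC. Qed.

Lemma adjacent_neq a b : adjacent a b -> a != b.
Proof. by apply: contraTneq => ->; rewrite /adjacent !subrr. Qed.

Lemma adjacent_color a b : adjacent a b -> color a + color b = 0.
Proof.
rewrite /adjacent /color /white => /eqP ab.
by case: ifP; case: ifP; lia.
Qed.

Lemma adjacent_colorN a b : adjacent a b -> color b = - color a.
Proof. by move=> /adjacent_color; lia. Qed.

End Weights.

(** * Holonomy of paths *)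

Section Holonomy.
Variables (D : region) (s : cell) (t w : cell -> int).

(** On D minus s, these are the products of the colour with functions constant on components; the
    value at s is free. *)
Definition cut_weight (h : cell -> int) : Prop :=
  forall a b, a \in D `\ s -> b \in D `\ s -> adjacent a b -> (h a + h b = 0)%R.

Hypotheses (tP : cut_weight t) (wP : cut_weight w).
Variables (G : groupType) (lam : int -> G).

Lemma weight_domino h d : cut_weight h -> domino d -> d `<=` D -> s \notin d ->
  weight h d = 0%R.
Proof.
move=> hP [a [b [ab ->]]] dD sd.
rewrite weight_pair ?adjacent_neq //.
have inDs c : c \in [fset a; b] -> c \in D `\ s.
  move=> cd; rewrite in_fsetD1 (fsubsetP dD _ cd) andbT.
  by apply: contraNneq sd => <-.
by apply: hP ab; apply: inDs; rewrite !inE eqxx ?orbT.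
Qed.

Lemma weight_tiling h A T : cut_weight h -> tiling A T -> A `<=` D ->
  s \notin A -> weight h A = 0%R.
Proof.
move=> hP [dT trivT <-] AD sA; rewrite /weight big_trivIfset //.
rewrite big_seq big1 // => d dinT.
have dA : d `<=` fcover T by exact: bigfcup_sup.
apply: (weight_domino hP (dT d dinT)); first exact: fsubset_trans AD.
exact: contra (fsubsetP dA s) sA.
Qed.

Lemma is_dartP e : is_dart D e ->
  [/\ dsource e `<=` D, dtarget e `<=` D, [disjoint dsource e & dtarget e]
    & exists T, tiling (D `\` (dsource e `|` dtarget e)) T].
Proof.
case/and5P=> /andP[sD _] /andP[tD _] dis /asboolP T _.
by split=> //; exists (dtiling e).
Qed.

(** Since s lies in one of the plugs, every domino of the floor avoids s and weighs nothing. *)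
Lemma weight_dart h e : cut_weight h -> is_dart D e ->
  s \in dsource e `|` dtarget e ->
  weight h D = (weight h (dsource e) + weight h (dtarget e))%R.
Proof.
move=> hP /is_dartP[sD tD dis [T tT]] se.
have stD : dsource e `|` dtarget e `<=` D by rewrite fsubUset sD.
apply/esym/eqP; rewrite -weightU // -subr_eq0 -opprB oppr_eq0 -weightD //.
apply/eqP; apply: (weight_tiling hP tT); first exact: fsubsetDl.
by rewrite inE se.
Qed.

(* For a weight vanishing off one component of D minus s, this says that the
   domino of the floor that covers s lies across s and that component. *)
Definition crosses (p q : region) : bool :=
  (weight t p + weight t q != weight t D)%R.

Lemma crossesC p q : crosses p q = crosses q p.
Proof. by rewrite /crosses addrC. Qed.

Local Open Scope group_scope.

(* b tells whether the dart starts at an odd position of the path. *)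
Definition dart_holonomy (b : bool) (e : dart) : G :=
  if crosses (dsource e) (dtarget e) then
    if b then (lam (weight w (dtarget e)))^-1 else lam (weight w (dsource e))
  else 1.

Fixpoint holonomy (b : bool) (u : seq dart) : G :=
  if u is e :: u' then dart_holonomy b e * holonomy (~~ b) u' else 1.

Lemma holonomy_cat b u v :
  holonomy b (u ++ v) = holonomy b u * holonomy (b (+) odd (size u)) v.
Proof.
elim: u b => [|e u IH] b /=; first by rewrite mul1g addbF.
by rewrite IH mulgA addNb addbN.
Qed.

(** The weight is read at the end of the dart that sits at an even position. Reversal with a change
    of parity keeps this end and swaps [lam] with its inverse. *)
Lemma dart_holonomy_rev b e :
  dart_holonomy (~~ b) (dart_rev e) = (dart_holonomy b e)^-1.
Proof.
rewrite /dart_holonomy /= crossesC; case: ifP => _; last by rewrite invg1.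
by case: b => //=; rewrite invgK.
Qed.

Lemma holonomy_rev b u :
  holonomy (b (+) odd (size u)) (path_rev u) = (holonomy b u)^-1.
Proof.
elim: u b => [|e u IH] b; first by rewrite invg1.
rewrite -cat1s path_rev_cat holonomy_cat /= addbN -addNb IH !mulg1 invgM.
congr (_ * _); rewrite -dart_holonomy_rev; congr (dart_holonomy _ _).
by rewrite /path_rev size_rev size_map -addbA addbb addbF.
Qed.

Lemma holonomy_boundary b p q c : boundary c -> is_path D p q c ->
  holonomy b c = 1.
Proof.
case=> [f ff _|p' q' T T' _ _ _|p1 p2 p3 p4 d T1 T2 dd d3 p2E].
- by rewrite /= /dart_holonomy ff mulg1; case: ifP; case: b; rewrite ?mulg1 ?mulgV ?mulVg.
- rewrite /= mulg1 -[edge q' p' T']/(Dart q' p' T' false) /dart_holonomy /=.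
  by rewrite (crossesC q'); case: ifP; case: b; rewrite ?mulg1 ?mulgV ?mulVg.
rewrite /is_path => /and3P[e12 _ /and3P[e24 _ /and3P[e43 _ /and3P[e31 _ _]]]].
have [_ p2D _ _] := is_dartP e12.
have dD : d `<=` D by move: p2D; rewrite /= p2E fsubUset => /andP[].
have w2 h : weight h p2 = (weight h p3 + weight h d)%R.
  by rewrite p2E weightU // fdisjoint_sym.
rewrite /= /dart_holonomy /= mulg1.
(* If d covers s, the two edges at [p2] have s in a plug and do not cross. Moreover [p1] and [p4]
   have equal weights, so the two edges at [p3] cancel. *)
have [sd|sd] := boolP (s \in d).
  have s2 : s \in p2 by rewrite p2E inE sd orbT.
  have E12 h : cut_weight h -> weight h D = (weight h p1 + weight h p2)%R.
    by move=> hP; apply: (weight_dart hP e12); rewrite inE s2 orbT.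
  have E24 h : cut_weight h -> weight h D = (weight h p2 + weight h p4)%R.
    by move=> hP; apply: (weight_dart hP e24); rewrite inE s2.
  have cr12 : crosses p1 p2 = false by rewrite /crosses -E12 // eqxx.
  have cr24 : crosses p2 p4 = false by rewrite /crosses -E24 // eqxx.
  have w14 h : cut_weight h -> weight h p1 = weight h p4.
    by move=> hP; apply: (addIr (weight h p2)); rewrite -E12 // addrC -E24.
  have cr31 : crosses p3 p1 = crosses p4 p3.
    by rewrite crossesC /crosses w14.
  rewrite cr12 cr24 cr31 !mul1g.
  by case: ifP => _; case: b => /=; rewrite ?mulg1 ?mulgV ?mulVg ?w14 ?mulgV.
(* If d avoids s, it weighs nothing and [p2], [p3] are indistinguishable: the two edges at [p4]
   cancel, then the two at [p1]. *)
have w23 h : cut_weight h -> weight h p2 = weight h p3.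
  by move=> hP; rewrite w2 (weight_domino hP dd dD sd) addr0.
have cr31 : crosses p3 p1 = crosses p1 p2 by rewrite crossesC /crosses w23.
have cr43 : crosses p4 p3 = crosses p2 p4 by rewrite crossesC /crosses w23.
rewrite cr31 cr43; case: b => /=; case: ifP => _; case: ifP => _;
  by rewrite ?w23 ?mul1g ?mulg1 ?mulKg ?mulVKg ?mulgV ?mulVg.
Qed.

Lemma homotopic_holonomy b p q u v :
  homotopic D p q u v -> holonomy b u = holonomy b v.
Proof.
elim=> [//|u1 u2 _ -> //|u2 u1 u3 _ -> _ //|u1 e v1 _|u1 c v1 cB].
  rewrite !holonomy_cat /= mulg1 dart_holonomy_rev mulgV mul1g.
  by rewrite addbF.
case/is_path_cat=> r1 _ /is_path_cat[r2 cP _].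
rewrite !holonomy_cat (holonomy_boundary _ cB cP) mul1g.
(* Boundaries have even length, so removing one preserves the parity of all later positions. *)
suff -> : odd (size c) = false by rewrite addbF.
by case: cB.
Qed.

End Holonomy.

(** * Holonomy values attained by explicit paths *)

Section Realization.
Variables (D : region) (s : cell) (t w : cell -> int).
Variables (G : groupType) (lam : int -> G).

Local Open Scope group_scope.

Definition reaches (A B : region) (g : G) : Prop :=
  exists u, [/\ is_path D A B u, ~~ odd (size u) & holonomy D t w lam false u = g].

Lemma reaches_trans B A C g h :
  reaches A B g -> reaches B C h -> reaches A C (g * h).
Proof.
move=> [u [uP uE <-]] [v [vP vE <-]]; exists (u ++ v); split.
- by apply/is_path_cat; exists B.
- by rewrite size_cat oddD (negbTE uE).
- by rewrite holonomy_cat (negbTE uE).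
Qed.

Lemma reaches_sym A B g : reaches A B g -> reaches B A g^-1.
Proof.
move=> [u [uP uE <-]]; exists (path_rev u); split; first exact: is_path_rev.
  by rewrite /path_rev size_rev size_map.
by rewrite -holonomy_rev (negbTE uE).
Qed.

Lemma tiling0 : tiling fset0 fset0.
Proof.
split=> //; first by apply/trivIfsetP => ? ?; rewrite inE.
by rewrite /fcover big_seq_fset0.
Qed.

Lemma tiling1 d : domino d -> tiling d [fset d].
Proof.
move=> dd; split.
- by move=> e; rewrite inE => /eqP->.
- by apply/trivIfsetP => e f; rewrite !inE => /eqP-> /eqP->; rewrite eqxx.
- by rewrite /fcover big_seq_fset1.
Qed.

(* The first floor leaves out d, which its tiling covers; the second floor is
   entirely vertical. *)
Lemma reaches_add A a b :
  A `<=` D -> balanced D -> balanced A -> adjacent a b ->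
  a \in D -> b \in D -> a \notin A -> b \notin A ->
  reaches A (A `|` [fset a; b])
    (if (t a + t b != 0)%R then lam (weight w A) else 1).
Proof.
move=> AD Dbal Abal ab aD bD aA bA; set d := [fset a; b].
have dd : domino d by exists a, b.
have dA : [disjoint A & d].
  by rewrite fdisjoint_sym; apply/fdisjointP => x; rewrite !inE => /orP[] /eqP->.
have dD : d `<=` D by apply/fsubsetP => x; rewrite !inE => /orP[] /eqP->.
have BD : A `|` d `<=` D by rewrite fsubUset AD.
have wd h : weight h d = (h a + h b)%R by rewrite weight_pair ?adjacent_neq.
have Bbal : balanced (A `|` d).
  by rewrite balancedE weightU // wd adjacent_color // addr0 -balancedE.
set B := A `|` d in BD Bbal *; set C := D `\` B.
have wC h : weight h C = (weight h D - weight h A - (h a + h b))%R.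
  by rewrite weightD // weightU // wd opprD addrA.
have Cbal : balanced C.
  rewrite balancedE wC adjacent_color //.
  by move: Dbal Abal; rewrite !balancedE => /eqP-> /eqP->.
have CD : C `<=` D by exact: fsubsetDl.
have CB : [disjoint C & B] by apply/fdisjointP => x; rewrite inE => /andP[].
have AC : [disjoint A & C].
  by apply/fdisjointP => x xA; rewrite !inE xA.
have DAC : D `\` (A `|` C) = d.
  apply/fsetP => x; have := fsubsetP dD x; have := fdisjointP dA x.
  rewrite !inE; case: (x \in A); case: (_ || _); case: (x \in D) => //= dA1 dD1;
    by [have := dA1 isT | have := dD1 isT].
have DCB : D `\` (C `|` B) = fset0.
  apply/fsetP => y; rewrite in_fsetD in_fsetU in_fsetD in_fset0.
  by case: (y \in B); case: (y \in D).
exists [:: edge A C [fset d]; edge C B fset0]; split=> //.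
  rewrite /is_path /= /is_dart /= /plug AD Abal CD Cbal BD Bbal AC CB DAC DCB.
  rewrite !eqxx !andbT /=.
  by apply/andP; split; apply/asboolP; [exact: tiling1 | exact: tiling0].
have crA : crosses D t A C = (t a + t b != 0)%R.
  rewrite /crosses wC; move: (weight t D) (weight t A) (t a) (t b) => x y z r.
  by clear -x; lia.
have crB : crosses D t C B = false.
  rewrite /crosses wC /B weightU // wd.
  by move: (weight t D) (weight t A) (t a) (t b) => x y z r; clear -x; lia.
by rewrite /= /dart_holonomy /= crA crB !mulg1.
Qed.

(* The walk around a hexagon in the lattice of colour imbalances: the domino
   over s turns successively to n1, n3, n2, n1, n3, n2, while n3 and m lend
   each other a square. *)
Lemma reaches_hexagon n1 n2 n3 m :
  balanced D -> s \in D -> n1 \in D -> n2 \in D -> n3 \in D -> m \in D ->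
  adjacent s n1 -> adjacent s n2 -> adjacent s n3 -> adjacent n3 m ->
  uniq [:: s; n1; n2; n3; m] ->
  (t s + t n1 != 0)%R -> (t s + t n2 = 0)%R -> (t s + t n3 = 0)%R ->
  (t n3 + t m = 0)%R ->
  reaches fset0 fset0 (lam 0%R * (lam (w m + w n2)%R)^-1).
Proof.
move=> Dbal sD n1D n2D n3D mD sn1 sn2 sn3 n3m.
rewrite /= !inE !negb_or => /and5P[/and4P[s1 s2 s3 sm] /and3P[n12 n13 n1m]
  /andP[n23 n2m] nm3 _] t1 t2 t3 tm.
have pairD x y : x \in D -> y \in D -> [fset x; y] `<=` D.
  by move=> xD yD; apply/fsubsetP => z; rewrite !inE => /orP[] /eqP->.
have pair_bal x y : x != y -> (color x + color y = 0)%R -> balanced [fset x; y].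
  by move=> xy cxy; rewrite balancedE weight_pair // cxy.
have c1 := adjacent_color sn1; have c2 := adjacent_color sn2.
have c3 := adjacent_color sn3; have cm := adjacent_color n3m.
have bal0 : balanced fset0 by rewrite balancedE weight0.
have step A B a b : A `<=` D -> balanced A -> adjacent a b ->
    a \in D -> b \in D -> a \notin A -> b \notin A -> B = A `|` [fset a; b] ->
  reaches A B (if (t a + t b != 0)%R then lam (weight w A) else 1).
  by move=> AD Abal ab aD bD aA bA ->; apply: reaches_add.
pose A1 := [fset s; n1]; pose A2 := A1 `|` [fset n3; m].
pose A3 := [fset n1; m]; pose A4 := A3 `|` [fset s; n2].
pose A5 := [fset m; n2]; pose A6 := A5 `|` [fset s; n3].
pose A7 := [fset s; n2].
have R1 : reaches fset0 A1 (lam 0%R).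
  have := @step fset0 A1 s n1; rewrite t1 weight0; apply=> //.
  by rewrite fset0U.
have R2 : reaches A1 A2 1.
  have := @step A1 A2 n3 m; rewrite tm eqxx; apply=> //.
  - exact: pairD.
  - exact: pair_bal.
  - by rewrite !inE negb_or eq_sym s3 eq_sym.
  - by rewrite !inE negb_or eq_sym sm eq_sym.
have R3 : reaches A3 A2 1.
  have := @step A3 A2 s n3; rewrite t3 eqxx; apply=> //.
  - exact: pairD.
  - by apply: pair_bal => //; move: c1 c2 c3 cm; clear; lia.
  - by rewrite !inE negb_or s1.
  - by rewrite !inE negb_or eq_sym n13.
  - apply/fsetP => x; rewrite !inE.
    by case: (x == s); case: (x == n1); case: (x == n3); case: (x == m).
have R4 : reaches A3 A4 1.
  have := @step A3 A4 s n2; rewrite t2 eqxx; apply=> //.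
  - exact: pairD.
  - by apply: pair_bal => //; move: c1 c2 c3 cm; clear; lia.
  - by rewrite !inE negb_or s1.
  - by rewrite !inE negb_or eq_sym n12.
have R5 : reaches A5 A4 (lam (w m + w n2)%R).
  have := @step A5 A4 s n1.
  rewrite t1 weight_pair 1?eq_sym //; apply=> //.
  - exact: pairD.
  - by apply: pair_bal; [rewrite eq_sym | move: c1 c2 c3 cm; clear; lia].
  - by rewrite !inE negb_or sm.
  - by rewrite !inE negb_or n1m.
  - apply/fsetP => x; rewrite !inE.
    by case: (x == s); case: (x == n1); case: (x == n2); case: (x == m).
have R6 : reaches A5 A6 1.
  have := @step A5 A6 s n3; rewrite t3 eqxx; apply=> //.
  - exact: pairD.
  - by apply: pair_bal; [rewrite eq_sym | move: c1 c2 c3 cm; clear; lia].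
  - by rewrite !inE negb_or sm.
  - by rewrite !inE negb_or nm3 eq_sym.
have R7 : reaches A7 A6 1.
  have := @step A7 A6 n3 m; rewrite tm eqxx; apply=> //.
  - exact: pairD.
  - exact: pair_bal.
  - by rewrite !inE negb_or eq_sym s3 eq_sym.
  - by rewrite !inE negb_or eq_sym sm eq_sym.
  - apply/fsetP => x; rewrite !inE.
    by case: (x == s); case: (x == n2); case: (x == n3); case: (x == m).
have R8 : reaches fset0 A7 1.
  have := @step fset0 A7 s n2; rewrite t2 eqxx; apply=> //.
  by rewrite fset0U.
have := reaches_trans R6 (reaches_trans (reaches_sym R7) (reaches_sym R8)).
move=> /(reaches_trans (reaches_trans R4 (reaches_sym R5))).
move=> /(reaches_trans (reaches_trans R1 (reaches_trans R2 (reaches_sym R3)))).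
by rewrite !invg1 !mulg1 mul1g.
Qed.

End Realization.

(** * The homomorphism defined by the holonomy on the even domino group *)

Section EvenHomomorphism.
Variables (D : region) (s : cell) (t w : cell -> int).
Hypotheses (tP : cut_weight D s t) (wP : cut_weight D s w).
Variables (G : groupType) (lam : int -> G).
Local Open Scope group_scope.
Local Notation class_group := (quotient_group (loop_setoid_group D)).

Definition loop_holonomy (g : domino_group D) : G :=
  holonomy D t w lam false (val (repr (g : class_group))).

Lemma loop_holonomyE u : loop_holonomy (path_class u) = holonomy D t w lam false (val u).
Proof.
apply: (@homotopic_holonomy D s t w tP wP G lam false fset0 fset0).
exact/(quotient_groupP (S := loop_setoid_group D))/reprK.
Qed.

Lemma even_predE (g : domino_group D) :
  even_pred g = ~~ odd (size (val (repr (g : class_group)))).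
Proof.
rewrite /even_pred inE /length_parity -val_eqE /= modn2.
by case: odd.
Qed.

Lemma even_predP (u : closed_path D) : even_pred (path_class u) = ~~ odd (size (val u)).
Proof.
by rewrite /even_pred inE length_parityE -val_eqE /= modn2; case: odd.
Qed.

Definition even_holonomy (g : even_domino_group D) : G := loop_holonomy (val g).

(** Evenness of the first factor makes the second path start again at an even position. *)
Fact even_holonomyM : {morph even_holonomy : g h / g * h}.
Proof.
move=> g h; have := valP g; rewrite even_predE => gE.
rewrite /even_holonomy [LHS]loop_holonomyE /= holonomy_cat.
by rewrite (negbTE gE).
Qed.

Lemma reaches_even_holonomy x :
  reaches D t w lam fset0 fset0 x -> exists g, even_holonomy g = x.
Proof.
move=> [u [uP uE <-]]; pose v : closed_path D := Sub u uP.
have vE : even_pred (path_class v) by rewrite even_predP.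
by exists (Sub (path_class v) vE); rewrite /even_holonomy loop_holonomyE.
Qed.

End EvenHomomorphism.

(** * Surjectivity onto the free group *)

Definition generator n (i : 'I_n) : free_group n :=
  \pi_(quotient_group (free_setoid_group n)) [:: (i, false)].

Lemma free_group_ind n (P : free_group n -> Prop) :
  P 1%g -> (forall i x, P x -> P (generator i * x)%g) ->
  (forall i x, P x -> P ((generator i)^-1 * x)%g) -> forall x, P x.
Proof.
move=> P1 PM PV x.
suff Pw u : P (\pi_(quotient_group (free_setoid_group n)) u).
  by have := Pw (repr (x : quotient_group (free_setoid_group n))); rewrite reprK.
elim: u => [|[i b] u IH]; first exact: P1.
case: b.
  have := PV i _ IH; rewrite /generator [(_^-1)%g]qg_invE [(_ * _)%g]qg_mulE.
  by [].
by have := PM i _ IH; rewrite /generator [(_ * _)%g]qg_mulE.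
Qed.

Lemma holonomy_strongly_irregular D s t w (lam : int -> free_group 2) :
  cut_weight D s t -> cut_weight D s w ->
  (forall i, reaches D t w lam fset0 fset0 (generator i)) ->
  strongly_irregular D.
Proof.
move=> tP wP gens; pose f := even_holonomy (D := D) t w lam.
have fM : {morph f : g h / (g * h)%g} := even_holonomyM tP wP lam.
have f1 : f 1%g = 1%g by apply: (mulgI (f 1%g)); rewrite -fM !mulg1.
have fV g : f (g^-1)%g = ((f g)^-1)%g.
  by apply: (mulIg (f g)); rewrite -fM !mulVg.
pose H := isMultiplicative.Build _ _ f fM.
exists (HB.pack_for {multiplicative even_domino_group D -> free_group 2} f H).
elim/free_group_ind => [|i x [g gx]|i x [g gx]].
- by exists 1%g.
- have [h hx] := reaches_even_holonomy tP wP (gens i).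
  by exists (h * g)%g; rewrite /= fM [f h]hx; congr (_ * _)%g.
- have [h hx] := reaches_even_holonomy tP wP (gens i).
  by exists (h^-1 * g)%g; rewrite /= fM fV [f h]hx; congr (_ * _)%g.
Qed.

(** * Components of the complement of a square *)

Section Components.
Variable A : region.

Local Notation edges := [rel a b : A | adjacent (val a) (val b)].

Lemma connect_edges_sym : connect_sym edges.
Proof. by apply: sym_connect_sym => a b /=; rewrite adjacent_sym. Qed.

Lemma connect_edges_equivalence :
  {in [set: A] & &, equivalence_rel (connect edges)}.
Proof.
by move=> a b c _ _ _; split=> [|ab]; [exact: connect0 | exact: (same_connect connect_edges_sym ab)].
Qed.

Lemma components_partition : partition (components A) [set: A].
Proof. exact: equivalence_partitionP connect_edges_equivalence. Qed.

Lemma mem_component C a b : C \in components A -> a \in C ->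
  (b \in C) = connect edges a b.
Proof.
move=> CA aC; have /and3P[_ triv _] := components_partition.
rewrite -(def_pblock triv CA aC).
by rewrite (pblock_equivalence_partition connect_edges_equivalence) ?inE.
Qed.

Lemma component_neighbor C a : C \in components A -> a \in C ->
  (1 < #|C|)%N -> exists2 b, b \in C & adjacent (val a) (val b).
Proof.
move=> CA aC /card_gt1P[b [c [bC cC bc]]].
have [d dC da] : exists2 d, d \in C & d != a.
  by have [ba|ba] := eqVneq b a; [exists c; rewrite // -ba eq_sym | exists b].
move: dC; rewrite (mem_component _ CA aC) => /connectP[[|e p] /= ep dE].
  by rewrite dE eqxx in da.
have /andP[ae _] := ep; exists e => //.
by rewrite (mem_component _ CA aC); apply: connect1.
Qed.

End Components.

(** Connectivity in the form of cuts: it directly provides an edge leaving a given component, and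
    its failure splits the realization into two closed parts. *)
Definition edge_connected (D : region) : Prop :=
  forall P : pred cell, (exists2 a, a \in D & P a) ->
    (exists2 b, b \in D & ~~ P b) ->
  exists a b, [/\ a \in D, b \in D, P a, ~~ P b & adjacent a b].

(** * Weights attached to components, and hexagons through three of them *)

Section Cut.
Variables (D : region) (s : cell).
Hypotheses (Dconn : edge_connected D) (Dbal : balanced D) (sD : s \in D).
Local Notation A := (D `\ s).
Local Notation comp := (components A).

(** Some edge of D leaves C. Its outer end can only be s, as any other square of D adjacent to C
    belongs to C. *)
Lemma component_touches C : C \in comp ->
  exists2 a, a \in C & adjacent s (val a).
Proof.
move=> CA; have /and3P[_ _ C0] := components_partition A.
have [a aC] : exists a, a \in C.
  by apply/set0Pn; apply: contraNneq C0 => <-.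
pose P c := [exists b in C, val b == c].
have PC b : P (val b) = (b \in C).
  apply/exists_inP/idP => [[c cC /eqP/val_inj <-] //|bC].
  by exists b => //; rewrite eqxx.
have inD (b : A) : val b \in D by have := valP b; rewrite in_fsetD1 => /andP[].
have NPs : ~~ P s.
  apply/exists_inPn => b _; have := valP b; by rewrite in_fsetD1 => /andP[].
have [||x [y [xD yD /exists_inP[b bC /eqP bx] NPy xy]]] := Dconn (P := P).
- by exists (val a); rewrite ?PC.
- by exists s.
exists b => //; rewrite bx adjacent_sym.
suff <- : y = s by [].
apply/eqP; apply: contraNT NPy => ys.
have yA : y \in A by rewrite in_fsetD1 ys.
rewrite -[y]/(val (Sub y yA : A)) PC (mem_component _ CA bC).
by apply: connect1; rewrite /= bx.
Qed.

(** The weight of a region becomes the combination, with coefficients [k], of its colour imbalances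
    in the components. The square s counts for 0, so with the indicator of one component a domino
    over s weighs something exactly when it enters that component. *)
Definition component_weight (k : {set A} -> int) (c : cell) : int :=
  if insub c is Some a then (color c * k (pblock comp a))%R else 0%R.

Lemma component_weightE k C a : C \in comp -> a \in C ->
  component_weight k (val a) = (color (val a) * k C)%R.
Proof.
move=> CA aC; rewrite /component_weight valK.
by have /and3P[_ triv _] := components_partition A; rewrite (def_pblock triv CA aC).
Qed.

Lemma component_weight0 k : component_weight k s = 0%R.
Proof. by rewrite /component_weight insubN // in_fsetD1 eqxx. Qed.

Lemma component_cut_weight k : cut_weight D s (component_weight k).
Proof.
move=> a b aA bA ab; have /and3P[/eqP covA _ _] := components_partition A.
pose a' : A := Sub a aA; pose b' : A := Sub b bA.
have CA : pblock comp a' \in comp by rewrite pblock_mem // covA inE.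
have a'C : a' \in pblock comp a' by rewrite mem_pblock covA inE.
have b'C : b' \in pblock comp a' by rewrite (mem_component _ CA a'C) connect1.
have := component_weightE k CA a'C; have := component_weightE k CA b'C.
by rewrite /= => -> ->; rewrite -mulrDl adjacent_color // mul0r.
Qed.

Lemma component_neq C C' a a' : C \in comp -> C' \in comp -> C != C' ->
  a \in C -> a' \in C' -> val a != val a'.
Proof.
move=> CA C'A; have /and3P[_ triv _] := components_partition A.
move=> CC' aC aC'; apply: contraNneq CC' => /val_inj aa'.
by rewrite -(def_pblock triv CA aC) -(def_pblock triv C'A aC') aa'.
Qed.

Lemma color_neq0 c : (color c != 0)%R.
Proof. by rewrite /color; case: ifP. Qed.

(** This is the hexagon walk with [n1], [n2], [n3] the squares where the components touch s. The
    auxiliary square [m] is a neighbour of [n3] inside [C3], whence the condition on the size of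
    [C3]. *)
Lemma reaches_components (k : {set A} -> int) (G : groupType) (lam : int -> G)
    C1 C2 C3 :
  C1 \in comp -> C2 \in comp -> C3 \in comp -> uniq [:: C1; C2; C3] ->
  (1 < #|C3|)%N ->
  reaches D (component_weight (fun C => (C == C1)%:Z)%R) (component_weight k) lam
    fset0 fset0 (lam 0%R * (lam (color s * (k C3 - k C2))%R)^-1)%g.
Proof.
move=> C1A C2A C3A; rewrite /= !inE negb_or => /and3P[/andP[C12 C13] C23 _] C3gt.
have [n1 n1C sn1] := component_touches C1A.
have [n2 n2C sn2] := component_touches C2A.
have [n3 n3C sn3] := component_touches C3A.
have [m mC n3m] := component_neighbor C3A n3C C3gt.
have inA (b : A) : (val b \in D) /\ (s != val b).
  by have := valP b; rewrite in_fsetD1 eq_sym => /andP[].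
have [n1D sn1'] := inA n1; have [n2D sn2'] := inA n2.
have [n3D sn3'] := inA n3; have [mD sm'] := inA m.
have ne C C' a a' := @component_neq C C' a a'.
set w := component_weight k; set t := component_weight _.
(* The square [m] has the colour of s and [n2] the opposite colour. *)
have -> : (color s * (k C3 - k C2) = w (val m) + w (val n2))%R.
  rewrite /w (component_weightE _ C3A mC) (component_weightE _ C2A n2C).
  rewrite (adjacent_colorN n3m) (adjacent_colorN sn3) (adjacent_colorN sn2).
  by rewrite opprK mulNr mulrBr.
have t0 C a : C \in comp -> a \in C -> C1 != C -> t (val a) = 0%R.
  by move=> CA aC; rewrite eq_sym /t (component_weightE _ CA aC) => /negbTE->; rewrite mulr0.
apply: (@reaches_hexagon D s t w G lam (val n1) (val n2) (val n3) (val m)) => //.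
- rewrite /= !inE !negb_or sn1' sn2' sn3' sm' (ne _ _ _ _ C1A C2A C12 n1C n2C).
  rewrite (ne _ _ _ _ C1A C3A C13 n1C n3C) (ne _ _ _ _ C1A C3A C13 n1C mC).
  rewrite (ne _ _ _ _ C2A C3A C23 n2C n3C) (ne _ _ _ _ C2A C3A C23 n2C mC).
  by rewrite (adjacent_neq n3m).
- by rewrite /t component_weight0 add0r (component_weightE _ C1A n1C) eqxx mulr1 color_neq0.
- by rewrite /t component_weight0 add0r -/t (t0 C2).
- by rewrite /t component_weight0 add0r -/t (t0 C3).
- by rewrite !(t0 C3).
Qed.

Lemma components_strongly_irregular (k : {set A} -> int) C1 C2 C3 C2' C3' :
  C1 \in comp -> C2 \in comp -> C3 \in comp -> C2' \in comp -> C3' \in comp ->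
  uniq [:: C1; C2; C3] -> uniq [:: C1; C2'; C3'] ->
  (1 < #|C3|)%N -> (1 < #|C3'|)%N ->
  (k C3 - k C2 = 1)%R -> (k C3' - k C2' = -1)%R ->
  strongly_irregular D.
Proof.
move=> C1A C2A C3A C2A' C3A' uC uC' C3gt C3gt' kC kC'.
(* Only the two values met by the hexagons carry a letter. As [lam 0] is trivial, the holonomy of
   each hexagon is the inverse of one generator, and the reversed walk gives the generator. *)
pose lam (z : int) : free_group 2 :=
  if z == color s then generator 0%R else
  if z == (- color s)%R then generator 1%R else 1%g.
have l0 : lam 0%R = 1%g.
  by rewrite /lam [(0 == - _)%R]eq_sym oppr_eq0 eq_sym (negbTE (color_neq0 s)).
have l1 : lam (color s) = generator 0%R by rewrite /lam eqxx.
have l2 : lam (- color s)%R = generator 1%R.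
  rewrite /lam eqxx; case: eqP => //; have := color_neq0 s; clear; lia.
apply: (@holonomy_strongly_irregular D s _ (component_weight k) lam).
- exact: (component_cut_weight (fun C => (C == C1)%:Z)%R).
- exact: component_cut_weight.
have R := reaches_components k lam C1A C2A C3A uC C3gt.
have R' := reaches_components k lam C1A C2A' C3A' uC' C3gt'.
rewrite kC l0 mulr1 l1 mul1g in R; rewrite kC' l0 mulrN1 l2 mul1g in R'.
move: R R' => /reaches_sym; rewrite invgK => R /reaches_sym; rewrite invgK => R'.
by case=> [[|[|//]]] lti; [move: R | move: R']; congr (reaches _ _ _ _ _ _ (generator _)); apply: val_inj.
Qed.

End Cut.

(** * Choice of the components from their sizes *)

Lemma color_sum_star (D : region) s : s \in D -> (forall c, c \in D `\ s -> adjacent s c) ->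
  weight color D = (color s * (2 - #|` D|%:Z))%R.
Proof.
move=> sD star; rewrite /weight (big_fsetD1 s) //= big_seq.
rewrite (eq_bigr (fun=> (- color s)%R)); last first.
  by move=> c /star/adjacent_color sc; lia.
rewrite -big_seq big_const_seq iter_addr addr0 count_predT -/(#|` _|).
rewrite (cardfsD1 s D) sD PoszD mulNrn -mulr_natr natz /=.
by move: (color s) #|` D `\ s| => x n; clear; lia.
Qed.

Lemma big_components_strongly_irregular D s :
  edge_connected D -> balanced D -> s \in D ->
  (3 <= #|components (D `\ s)|)%N ->
  (\max_(C in components (D `\ s)) #|C| <= #|` D| - 4)%N ->
  strongly_irregular D.
Proof.
move=> Dconn Dbal sD; set P := components (D `\ s) => P3 Pmax.
have /and3P[/eqP covP triv P0] := components_partition (D `\ s).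
have sumP : (\sum_(C in P) #|C| = #|` D| - 1)%N.
  rewrite -(card_partition (components_partition (D `\ s))) cardsT -cardfE.
  by rewrite (cardfsD1 s D) sD addKn.
have [C3 C3P maxE] := eq_bigmax_cond (fun C : {set D `\ s} => #|C|) (ltnW (ltnW P3)).
rewrite maxE in Pmax.
have C3max C : C \in P -> (#|C| <= #|C3|)%N.
  by move=> CP; rewrite -maxE; apply: leq_bigmax_cond.
have C3gt0 : (0 < #|C3|)%N.
  by rewrite card_gt0; apply: contraNneq P0 => <-.
(* The components other than the largest one, [C3], have |D| - 1 - |C3| squares in all. The
   subtraction in the bound is truncated, but [C3] is nonempty, which forces |D| to be at least
   5. *)
have others : (3 <= \sum_(C in P :\ C3) #|C|)%N.
  have -> : (\sum_(C in P :\ C3) #|C| = #|` D| - 1 - #|C3|)%N.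
    have split3 : (\sum_(C in P) #|C| = #|C3| + \sum_(C in P :\ C3) #|C|)%N.
      exact: big_setD1.
    by rewrite -sumP split3 addKn.
  by move: Pmax C3gt0; move: #|` D| #|C3| => n c; clear; lia.
have [|small] := boolP [exists C in P :\ C3, (1 < #|C|)%N].
  case/exists_inP=> C2; rewrite !inE => /andP[C23 C2P] C2gt.
  have C3gt : (1 < #|C3|)%N by apply: leq_trans (C3max _ C2P).
  have [C1] : exists C1, C1 \in P :\ C3 :\ C2.
    apply/set0Pn; rewrite -card_gt0.
    by move: P3; rewrite (cardsD1 C3) C3P (cardsD1 C2 (P :\ C3)) !inE C23 C2P; lia.
  rewrite !inE => /and3P[C12 C13 C1P].
  (* Both [C2] and [C3] have two squares: the two hexagons exchange their roles, which changes the
     sign of the difference of [k]. *)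
  apply: (@components_strongly_irregular D s Dconn Dbal sD
    (fun C => (C == C2)%:Z)%R C1 C3 C2 C2 C3) => //.
  - by rewrite /= !inE !negb_or C12 C13 eq_sym C23.
  - by rewrite /= !inE !negb_or C12 C13 C23.
  - by rewrite eqxx eq_sym (negbTE C23).
  - by rewrite eqxx eq_sym (negbTE C23).
have le1 C : C \in P -> C != C3 -> (#|C| <= 1)%N.
  move=> CP C3C; rewrite leqNgt; apply: contra small => Cgt.
  by apply/exists_inP; exists C; rewrite // !inE C3C.
(* The other components are now single squares with at least three squares in all. *)
have : (3 <= #|P :\ C3|)%N.
  apply: leq_trans others _; rewrite -sum1_card; apply: leq_sum => C.
  by rewrite !inE => /andP[? ?]; apply: le1.
case/card_gt2P=> C1 [C2 [C4 [[]]]]; rewrite !inE.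
move=> /andP[C13 C1P] /andP[C23 C2P] /andP[C43 C4P] [C12 C24 C41].
(* If [C3] were a single square, all components would be, so D would consist of s and its
   neighbours; the colour sum [color s * (2 - |D|)] would not vanish. *)
have C3gt : (1 < #|C3|)%N.
  rewrite ltnNge; apply: contraTN Dbal => C3le.
  rewrite balancedE (color_sum_star sD) => [|c cA].
    rewrite mulf_neq0 ?color_neq0 //.
    by move: Pmax C3gt0; move: #|` D| #|C3| => n c; clear; lia.
  have : Sub c cA \in cover P by rewrite covP inE.
  case/bigcupP=> C CP cC.
  have [a aC sa] := component_touches Dconn sD CP.
  have Cle : (#|C| <= 1)%N by apply: leq_trans (C3max _ CP) _.
  by move/card_le1_eqP: Cle => /(_ _ _ aC cC) ac; move: sa; rewrite -ac.
(* Both hexagons use the two squares of [C3]; they differ by the single square, in [C2] or in [C4],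
   on which [k] has opposite values. *)
apply: (@components_strongly_irregular D s Dconn Dbal sD
  (fun C => (C == C4)%:Z - (C == C2)%:Z)%R C1 C2 C3 C4 C3) => //.
- by rewrite /= !inE !negb_or C12 C13 C23.
- by rewrite /= !inE !negb_or eq_sym C41 C13 C43.
- by rewrite eqxx eq_sym (negbTE C43) eq_sym (negbTE C23) (negbTE C24).
- by rewrite eqxx eq_sym (negbTE C43) eq_sym (negbTE C23) eq_sym (negbTE C24).
Qed.

(** * Disks are connected through edges *)

Section DiskConnectivity.
Import classical_sets functions cardinality filter topology.
Import normedtype numFieldNormedType.Exports.
Local Open Scope classical_set_scope.
Local Open Scope ring_scope.
Variable R : realType.
Implicit Types (a b c x : R * R) (F : set (R * R)).

Lemma closed_unit_square (c : cell) : closed (@unit_square R c).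
Proof.
have -> : @unit_square R c =
    (fst @^-1` ([set y | c.1%:~R <= y] `&` [set y | y <= c.1%:~R + 1])) `&`
    (snd @^-1` ([set y | c.2%:~R <= y] `&` [set y | y <= c.2%:~R + 1])).
  apply/seteqP; split=> x /=; first by move=> [/andP[? ?] /andP[? ?]].
  by move=> [[l1 u1] [l2 u2]]; split; apply/andP.
apply: closedI; apply: closed_comp => [x _|]; first exact: cvg_fst.
- by apply: closedI; [exact: closed_ge | exact: closed_le].
- exact: cvg_snd.
- by apply: closedI; [exact: closed_ge | exact: closed_le].
Qed.

Lemma closed_realization (A : region) : closed (@realization R A).
Proof.
have -> : @realization R A = \bigcup_(c in [set` A]) @unit_square R c by [].
by apply: closed_bigcup => [|c _]; [exact: finite_fset | exact: closed_unit_square].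
Qed.

Lemma unit_square_le (a b : cell) x : @unit_square R a x -> @unit_square R b x ->
  [/\ (a.1 <= b.1 + 1)%R, (b.1 <= a.1 + 1)%R, (a.2 <= b.2 + 1)%R &
   (b.2 <= a.2 + 1)%R].
Proof.
move=> [/andP[a1 a1'] /andP[a2 a2']] [/andP[b1 b1'] /andP[b2 b2']].
by split; rewrite -(ler_int R) intrD; lra.
Qed.

(** Both coordinates of such squares differ by exactly one, and two consecutive unit intervals meet
    at the larger of their left ends. *)
Lemma unit_square_corner (a b : cell) x :
  @unit_square R a x -> @unit_square R b x -> a != b -> ~~ adjacent a b ->
  x = ((Num.max a.1 b.1)%:~R, (Num.max a.2 b.2)%:~R).
Proof.
move=> ax bx ab nadj; have [l1 l1' l2 l2'] := unit_square_le ax bx.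
have ne1 : (a.1 == b.1 + 1) || (b.1 == a.1 + 1).
  move: a b ab nadj l1 l1' l2 l2' {ax bx} => [a1 a2] [b1 b2].
  by rewrite xpair_eqE /adjacent /=; lia.
have ne2 : (a.2 == b.2 + 1) || (b.2 == a.2 + 1).
  move: a b ab nadj l1 l1' l2 l2' {ax bx ne1} => [a1 a2] [b1 b2].
  by rewrite xpair_eqE /adjacent /=; lia.
case: ax bx => /andP[a1 a1'] /andP[a2 a2'] [/andP[b1 b1'] /andP[b2 b2']].
have corner (p q : int) (y : R) : (p == q + 1) || (q == p + 1) ->
    p%:~R <= y -> y <= p%:~R + 1 -> q%:~R <= y -> y <= q%:~R + 1 ->
    y = (Num.max p q)%:~R.
  case/orP=> /eqP->; rewrite intrD => *.
    by rewrite max_l ?lerDl // intrD; lra.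
  by rewrite max_r ?lerDl // intrD; lra.
by case: x a1 a1' a2 a2' b1 b1' b2 b2' => x1 x2 *; congr (_, _); apply: corner.
Qed.

Definition segment_point a c (r : R) : R * R :=
  (a.1 + r * (c.1 - a.1), a.2 + r * (c.2 - a.2)).

Lemma segment_point_disk a c r : @closed_disk R a -> @closed_disk R c ->
  0 <= r -> r <= 1 -> @closed_disk R (segment_point a c r).
Proof.
case: a c => [a1 a2] [c1 c2]; rewrite /closed_disk /= => Da Dc r0 r1.
have -> : (a1 + r * (c1 - a1)) ^+ 2 + (a2 + r * (c2 - a2)) ^+ 2 =
  (1 - r) * (a1 ^+ 2 + a2 ^+ 2) + r * (c1 ^+ 2 + c2 ^+ 2)
  - r * (1 - r) * ((a1 - c1) ^+ 2 + (a2 - c2) ^+ 2) by ring.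
have : 0 <= r * (1 - r) * ((a1 - c1) ^+ 2 + (a2 - c2) ^+ 2).
  by apply: mulr_ge0; [rewrite mulr_ge0 ?subr_ge0 | rewrite addr_ge0 ?sqr_ge0].
nra.
Qed.

Lemma continuous_segment_point a c : continuous (segment_point a c).
Proof.
have line (y z : R) : continuous (fun r : R => y + r * (z - y)).
  move=> r; apply: cvgD; first exact: cvg_cst.
  by apply: cvgM; [exact: cvg_id | exact: cvg_cst].
by move=> r; exact: cvg_pair (line a.1 c.1 r) (line a.2 c.2 r).
Qed.

Lemma finite_avoid (T : set R) : finite_set T ->
  exists2 r, 0 < r < 1 / 2 & ~ T r.
Proof.
move=> Tfin; pose f (n : nat) : R := n.+3%:R^-1.
have f_inj : injective f by move=> m n /invr_inj /eqP; rewrite eqr_nat => /eqP[].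
apply: contrapT => noT; apply: infinite_nat.
suff -> : [set: nat] = f @^-1` T by apply: finite_preimage => // ? ? _ _ /f_inj.
apply/seteqP; split=> // n _ /=; apply: contrapT => nT; apply: noT.
exists (f n) => //; rewrite invr_gt0 ltr0n /= mul1r ltf_pV2 ?posrE ?ltr0n //.
by rewrite ltr_nat.
Qed.

(* A point c on the perpendicular bisector of ab: seen from a, as well as from
   b, each point of F hides at most one point of that line. *)
Lemma disk_avoid a b F : finite_set F -> @closed_disk R a -> @closed_disk R b ->
  ~ F a -> ~ F b -> a != b ->
  exists2 c, @closed_disk R c & forall r,
    ~ F (segment_point a c r) /\ ~ F (segment_point b c r).
Proof.
case: a b => [a1 a2] [b1 b2] Ffin Da Db Fa Fb ab.
pose m1 := (a1 + b1) / 2; pose m2 := (a2 + b2) / 2.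
pose d1 := (b1 - a1) / 2; pose d2 := (b2 - a2) / 2.
have d0 : d1 ^+ 2 + d2 ^+ 2 != 0.
  apply: contraNneq ab => d0.
  have /eqP := d0; rewrite paddr_eq0 ?sqr_ge0 // !sqrf_eq0 => /andP[/eqP e1 /eqP e2].
  by apply/eqP; rewrite /d1 /d2 in e1 e2; congr (_, _); lra.
(* The vector n is the half-difference d rotated by a right angle, with the sign [e] making its
   inner product with the midpoint m nonpositive. Then |m + t n|^2 is at most |m|^2 + |d|^2, the
   mean of |a|^2 and |b|^2, so c stays in the disk. *)
have [e e2 em] : exists2 e : R, e ^+ 2 = 1 & e * (m2 * d1 - m1 * d2) <= 0.
  have [le0|/ltW ge0] := lerP (m2 * d1 - m1 * d2) 0.
    by exists 1; rewrite ?expr1n ?mul1r.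
  by exists (-1); rewrite ?sqrrN ?expr1n // mulN1r oppr_le0.
pose n1 := - e * d2; pose n2 := e * d1.
(* This is the [t] for which x lies on the line through p with direction h + t n, found by setting a
   cross product to zero. Here h is d seen from a and -d seen from b. *)
pose bad (p : R * R) (h1 h2 : R) x : R :=
  - (h1 * (x.2 - p.2) - h2 * (x.1 - p.1)) / (n1 * (x.2 - p.2) - n2 * (x.1 - p.1)).
have [t /andP[t0 t1] tbad] : exists2 t, 0 < t < 1 / 2 &
    ~ (bad (a1, a2) d1 d2 @` F `|` bad (b1, b2) (- d1) (- d2) @` F) t.
  by apply: finite_avoid; rewrite finite_setU; split; apply: finite_image.
pose c := (m1 + t * n1, m2 + t * n2).
have notbad (p : R * R) h1 h2 r : ~ F p -> ~ (bad p h1 h2 @` F) t ->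
    h1 ^+ 2 + h2 ^+ 2 != 0 -> n1 * h1 + n2 * h2 = 0 ->
    n1 ^+ 2 + n2 ^+ 2 = h1 ^+ 2 + h2 ^+ 2 ->
    c = (p.1 + h1 + t * n1, p.2 + h2 + t * n2) -> ~ F (segment_point p c r).
  move=> Fp Tp h0 nh nn cE Fx; set x := segment_point p c r in Fx.
  have v1 : x.1 - p.1 = r * (h1 + t * n1) by rewrite /x /segment_point cE /=; ring.
  have v2 : x.2 - p.2 = r * (h2 + t * n2) by rewrite /x /segment_point cE /=; ring.
  have cross : (h1 * (x.2 - p.2) - h2 * (x.1 - p.1))
      + t * (n1 * (x.2 - p.2) - n2 * (x.1 - p.1)) = 0 by rewrite v1 v2; ring.
  (* If the denominator of [bad] vanishes, x - p is parallel to n. As h is nonzero and orthogonal to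
     n, this leaves only x = p, which is not in F. *)
  have [nx0|nx0] := eqVneq (n1 * (x.2 - p.2) - n2 * (x.1 - p.1)) 0; last first.
    apply: Tp; exists x => //; rewrite /bad; apply: (mulIf nx0).
    by rewrite mulfVK //; lra.
  rewrite nx0 mulr0 addr0 in cross.
  have r0 : r = 0.
    have : r * (n1 * h2 - n2 * h1) = 0 by rewrite -nx0 v1 v2; ring.
    move/eqP; rewrite mulf_eq0 => /orP[/eqP //|/eqP nh0].
    have : (h1 ^+ 2 + h2 ^+ 2) ^+ 2 = 0.
      (* Lagrange's identity, with |n| = |h|. *)
      transitivity ((n1 * h1 + n2 * h2) ^+ 2 + (n1 * h2 - n2 * h1) ^+ 2).
        by rewrite expr2 -{1}nn; ring.
      by rewrite nh nh0 expr0n addr0.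
    by move/eqP; rewrite sqrf_eq0 (negbTE h0).
  apply: Fp; move: Fx; rewrite /x /segment_point r0 !mul0r !addr0.
  by case: p {x Tp cE v1 v2 cross nx0}.
have nn : n1 ^+ 2 + n2 ^+ 2 = d1 ^+ 2 + d2 ^+ 2.
  by rewrite /n1 /n2 !exprMn sqrrN e2; ring.
have nd : n1 * d1 + n2 * d2 = 0 by rewrite /n1 /n2; ring.
exists c.
  rewrite /closed_disk /=.
  have mE : m1 ^+ 2 + m2 ^+ 2 + (d1 ^+ 2 + d2 ^+ 2) =
      ((a1 ^+ 2 + a2 ^+ 2) + (b1 ^+ 2 + b2 ^+ 2)) / 2.
    by rewrite /m1 /m2 /d1 /d2; field.
  rewrite /closed_disk /= in Da Db.
  have cE : (m1 + t * n1) ^+ 2 + (m2 + t * n2) ^+ 2 = m1 ^+ 2 + m2 ^+ 2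
      + 2 * t * (e * (m2 * d1 - m1 * d2)) + t ^+ 2 * (d1 ^+ 2 + d2 ^+ 2).
    by rewrite -nn /n1 /n2; ring.
  have te : 2 * t * (e * (m2 * d1 - m1 * d2)) <= 0.
    by rewrite mulr_ge0_le0 // mulr_ge0 // ltW.
  have tn : t ^+ 2 * (d1 ^+ 2 + d2 ^+ 2) <= d1 ^+ 2 + d2 ^+ 2.
    rewrite -[leRHS]mul1r ler_wpM2r ?addr_ge0 ?sqr_ge0 // expr_le1 ?ltW //.
    lra.
  by rewrite cE; lra.
move=> r; split.
  apply: (notbad (a1, a2) d1 d2) => //.
    by move=> Ta; apply: tbad; left.
  by congr (_, _); rewrite /= /m1 /m2 /d1 /d2; field.
apply: (notbad (b1, b2) (- d1) (- d2)) => //.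
- by move=> Tb; apply: tbad; right.
- by rewrite !sqrrN.
- by rewrite !mulrN -opprD nd oppr0.
- by rewrite !sqrrN.
- by congr (_, _); rewrite /= /m1 /m2 /d1 /d2; field.
Qed.

Definition center (c : cell) : R * R := (c.1%:~R + 1 / 2, c.2%:~R + 1 / 2).

Lemma unit_square_center (c : cell) : @unit_square R c (center c).
Proof. by rewrite /unit_square /=; split; lra. Qed.

Lemma unit_square_centerE (c d : cell) : @unit_square R d (center c) -> d = c.
Proof.
rewrite /unit_square /= => -[/andP[l1 u1] /andP[l2 u2]].
have eq_int (m n : int) : m%:~R <= n%:~R + 1 / 2 :> R ->
    n%:~R + 1 / 2 <= m%:~R + 1 :> R -> m = n.
  move=> l u; have : (m < n + 1)%R by rewrite -(ltr_int R) intrD; lra.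
  have : (n < m + 1)%R by rewrite -(ltr_int R) intrD; lra.
  by clear; lia.
by case: c d l1 u1 l2 u2 => [c1 c2] [d1 d2] /= *; congr (_, _); apply: eq_int.
Qed.

(** Each pair of squares meets in at most one corner. *)
Lemma finite_realizationI (A B : region) :
  (forall c d : cell, c \in A -> d \in B -> c != d /\ ~~ adjacent c d) ->
  finite_set (@realization R A `&` @realization R B).
Proof.
move=> AB; pose corner (p : cell * cell) : R * R :=
  ((Num.max p.1.1 p.2.1)%:~R, (Num.max p.1.2 p.2.2)%:~R).
apply: (@sub_finite_set _ _ (corner @` ([set` A] `*` [set` B]))).
  move=> x [[c cA xc] [d dB xd]]; exists (c, d) => //.
  by have [cd nadj] := AB c d cA dB; rewrite (unit_square_corner xc xd cd nadj).
by apply/finite_image/finite_setX; exact: finite_fset.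
Qed.

(** Away from the intersection of K and L, their traces on C are separated sets. *)
Lemma connected_closed_cover (T : topologicalType) (C K L : set T) :
  connected C -> closed K -> closed L -> C `<=` K `|` L ->
  C `&` (K `&` L) = set0 -> C `<=` K \/ C `<=` L.
Proof.
move=> Cconn Kc Lc CKL C0.
have clC (M : set T) : closed M -> closure (C `&` M) `<=` M.
  move=> Mc x /(closureI (A := C) (B := M)) [_]; by rewrite -(closure_id M).1.
have CC : C `<=` (C `&` K) `|` (C `&` L).
  by move=> x Cx; case: (CKL x Cx); [left | right].
have sep : separated (C `&` K) (C `&` L).
  split; apply/seteqP; split=> // x.
    by move=> [/clC Kx [Cx Lx]]; rewrite -C0; split=> //; split=> //; exact: Kx.
  by move=> [[Cx Kx] /clC Lx]; rewrite -C0; split=> //; split=> //; exact: Lx.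
by have [sub|sub] := connected_subset sep CC Cconn; [left | right] => x /sub[].
Qed.

(** Without such an edge, the squares in P and the other ones form closed sets K and L with finite
    intersection. In the disk, the images of two centres, one on each side, are joined through a
    point c by two segments avoiding the image F of this intersection; pulled back, c would lie in
    both K and L. *)
Lemma disk_edge_connected (D : region) :
  quadriculated_disk R D -> edge_connected D.
Proof.
move=> [f [g [[fD finj fsurj] fK _ gc]]] P [a aD Pa] [b bD Pb].
apply: contrapT => nadj.
pose A := [fset c in D | P c]%fset; pose B := [fset c in D | ~~ P c]%fset.
have AB (c d : cell) : c \in A -> d \in B -> c != d /\ ~~ adjacent c d.
  rewrite !inE /= => /andP[cD Pc] /andP[dD Pd]; split.
    by apply: contraNneq Pd => <-.
  by apply/negP => cd; apply: nadj; exists c, d.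
set K := @realization R A; set L := @realization R B.
have DKL : @realization R D `<=` K `|` L.
  move=> x [c cD xc]; have [Pc|Pc] := boolP (P c); [left | right];
    by exists c; rewrite ?inE ?cD.
have fgK y : @closed_disk R y -> @realization R D (g y) /\ f (g y) = y.
  by move=> /fsurj[x xD <-]; rewrite fK ?inE.
pose F := f @` (K `&` L).
have Ffin : finite_set F by apply/finite_image/finite_realizationI.
have cD (c : cell) : c \in D -> @realization R D (center c).
  by move=> cD; exists c => //; exact: unit_square_center.
have KLD : K `&` L `<=` @realization R D.
  by move=> x [[c cA xc] _]; exists c => //; move: cA; rewrite !inE => /andP[].
have nK : ~ K (center b).
  by move=> [c cA /unit_square_centerE cb]; move: cA; rewrite cb !inE (negbTE Pb) andbF.
have nL : ~ L (center a).
  by move=> [c cB /unit_square_centerE ca]; move: cB; rewrite ca !inE Pa andbF.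
have nF (c : cell) : c \in D -> ~ (K `&` L) (center c) -> ~ F (f (center c)).
  move=> cinD ncKL [x xKL fx]; apply: ncKL.
  rewrite -(finj x (center c)) // inE; [exact: KLD | exact: cD].
have ab : f (center a) != f (center b).
  apply/eqP => /finj ce; apply: nK; rewrite -ce ?inE; [|exact: cD..].
  by exists a; [rewrite !inE aD | exact: unit_square_center].
have [c Dc cF] := disk_avoid Ffin (fD _ (cD _ aD)) (fD _ (cD _ bD))
  (nF a aD (fun h => nL h.2)) (nF b bD (fun h => nK h.1)) ab.
(* The image under [g] of the segment from x to c is connected and misses the intersection of K and
   L, so it stays on one side. *)
have side x : @closed_disk R x -> (forall r, ~ F (segment_point x c r)) ->
    (K (g x) /\ K (g c)) \/ (L (g x) /\ L (g c)).
  move=> Dx xF; pose S := segment_point x c @` `[0, 1].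
  have SD : S `<=` @closed_disk R.
    move=> _ [r /= /itvP r01 <-]; apply: segment_point_disk => //; by rewrite r01.
  have Sx : S x.
    exists 0; first by rewrite /= in_itv /= lexx ler01.
    by case: x {Dx xF S SD} => x1 x2; rewrite /segment_point !mul0r !addr0.
  have Sc : S c.
    exists 1; first by rewrite /= in_itv /= lexx ler01.
    by rewrite /segment_point !mul1r !subrKC -surjective_pairing.
  have gSconn : connected (g @` S).
    apply: connected_continuous_connected; last exact: continuous_subspaceW gc.
    apply: connected_continuous_connected; first exact: segment_connected.
    exact/continuous_subspaceT/continuous_segment_point.
  have gS0 : g @` S `&` (K `&` L) = set0.
    apply/seteqP; split=> // _ [[y Sy <-] KLy].
    have [r _ ry] := Sy; apply: (xF r); rewrite ry.
    by exists (g y) => //; have [] := fgK y (SD _ Sy).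
  have gSD : g @` S `<=` K `|` L.
    by move=> _ [y /SD/fgK[yD _] <-]; exact: DKL.
  have [sub|sub] := connected_closed_cover gSconn (@closed_realization A)
    (@closed_realization B) gSD gS0; [left | right];
  by split; apply: sub; apply: imageP.
have gf (d : cell) : d \in D -> g (f (center d)) = center d.
  by move=> dD; rewrite fK // inE; exact: cD.
have Kc : K (g c).
  have [|r|[_ //]|[]] := side (f (center a)); first exact/fD/cD.
  - by case: (cF r).
  - by rewrite gf.
have Lc : L (g c).
  have [|r|[]|[_ //]] := side (f (center b)); first exact/fD/cD.
  - by case: (cF r).
  - by rewrite gf.
(* At parameter 1 the segment is at c, which therefore is not in F. *)
have [nFc _] := cF 1; apply: nFc.
exists (g c) => //; rewrite (fgK c Dc).2.
by rewrite /segment_point !mul1r !subrKC -surjective_pairing.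
Qed.

End DiskConnectivity.

Theorem theorem3 (R : realType) (D : region) (s : cell) :
  quadriculated_disk R D ->
  balanced D ->
  s \in D ->
  (3 <= #|components (D `\ s)|)%N ->
  (\max_(C in components (D `\ s)) #|C| <= #|` D| - 4)%N ->
  strongly_irregular D.
Proof.
move=> /disk_edge_connected; exact: big_components_strongly_irregular.
Qed.
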